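(* Let $\kappa$ and $\lambda$ be infinite cardinals with $\lambda<\kappa$. Let $X$ be the discrete (disjoint) sum of $2^\kappa$ and $2^\lambda$, and let $Y$ be the quotient space obtained by collapsing the two points $\langle 0\rangle_{\alpha<\kappa}\in 2^\kappa$ and $\langle 0\rangle_{\alpha<\lambda}\in2^\lambda$ to a single point. If $\lambda<\mathrm{cf}\,\kappa$, then $Nt(Y)=\kappa^+$. If $\lambda\geq\mathrm{cf}\,\kappa$, then $Nt(Y)=\kappa$.
   Context: Families of open sets are ordered by inclusion; a family is $\mu^{\mathrm{op}}$-like if no member is contained in $\mu$-many members. The Noetherian type $Nt(Y)$ is the least $\mu\geq\omega$ such that $Y$ has a $\mu^{\mathrm{op}}$-like base. *)

(* Defs.v *)
From HB Require Import structures.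
From mathcomp Require Import all_boot all_order all_algebra.
From mathcomp Require Import all_classical all_reals all_analysis.
From mathcomp Require Import generic_quotient.
Local Open Scope classical_set_scope.
Local Open Scope card_scope.

Set Implicit Arguments.
Unset Strict Implicit.
Unset Printing Implicit Defensive.

Definition card_lt (T U : Type) (A : set T) (B : set U) :=
  A #<= B /\ ~ (B #<= A).

(** A family [F] is [M]^op-like (M a type standing for the cardinal |M|)
    if no member of [F] is contained in |M|-many members of [F]. *)
Definition op_like (T : Type) (M : Type) (F : set (set T)) :=
  forall U, F U -> ~ ([set: M] #<= [set V | F V /\ U `<=` V]).

(** [Nt_is T M] : the Noetherian type of [T] is the cardinal |M|, i.e. |M| is
    the least infinite cardinal mu such that [T] has a mu^op-like base. *)
Definition Nt_is (T : topologicalType) (M : Type) :=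
  [/\ infinite_set [set: M],
      (exists B : set (set T), basis B /\ op_like M B) &
      (forall N : Type, infinite_set [set: N] -> card_lt [set: N] [set: M] ->
         ~ exists B : set (set T), basis B /\ op_like N B)].

Definition is_succ_card (K P : Type) :=
  card_lt [set: K] [set: P] /\
  (forall N : Type, card_lt [set: K] [set: N] -> [set: P] #<= [set: N]).

Definition initial_wellorder (K : Type) (R : K -> K -> Prop) :=
  [/\ well_founded R,
      (forall x y z, R x y -> R y z -> R x z),
      (forall x y, [\/ R x y, x = y | R y x]) &
      (forall x, card_lt [set y | R y x] [set: K])].

Definition cf_le (L K : Type) :=
  exists R : K -> K -> Prop, initial_wellorder R /\
  exists C : set K, (forall x, exists2 y, C y & (x = y \/ R x y)) /\
                    C #<= [set: L].

Definition cube (K L : Type) (b : bool) : topologicalType :=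
  if b then ({ptws K -> bool} : topologicalType)
  else ({ptws L -> bool} : topologicalType).

Definition dsum (K L : Type) : topologicalType := {b : bool & cube K L b}.

Definition zeroK (K L : Type) : dsum K L :=
  existT (cube K L) true (fun _ : K => false).
Definition zeroL (K L : Type) : dsum K L :=
  existT (cube K L) false (fun _ : L => false).

Definition collapse (K L : Type) : rel (dsum K L) := fun x y =>
  (x == y) || (((x == zeroK K L) || (x == zeroL K L)) &&
               ((y == zeroK K L) || (y == zeroL K L))).

Arguments collapse : clear implicits.

Lemma collapse_refl (K L : Type) : reflexive (collapse K L).
Proof. by move=> x; rewrite /collapse eqxx. Qed.

Lemma collapse_sym (K L : Type) : symmetric (collapse K L).
Proof.
move=> x y; rewrite /collapse eq_sym; congr (_ || _); exact: andbC.
Qed.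

Lemma collapse_trans (K L : Type) : transitive (collapse K L).
Proof.
move=> y x z; rewrite /collapse.
case/orP=> [/eqP -> //|/andP [hx hy]].
case/orP=> [/eqP <-|/andP [_ hz]]; first by rewrite hx hy orbT.
by rewrite hx hz orbT.
Qed.

Canonical collapse_equiv (K L : Type) : equiv_rel (dsum K L) :=
  EquivRel (collapse K L) (@collapse_refl K L) (@collapse_sym K L)
    (@collapse_trans K L).

Local Open Scope quotient_scope.
Definition Yquot (K L : Type) : Type := {eq_quot collapse K L}.
HB.instance Definition _ (K L : Type) := Choice.on (Yquot K L).
HB.instance Definition _ (K L : Type) := EqQuotient.on (Yquot K L).

Definition Yspace (K L : Type) : topologicalType :=
  quotient_topology (Yquot K L).

(* Main.v *)
Require Import Defs.
From Stdlib Require Import Wellfounded Relation_Operators.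
From HB Require Import structures.
From mathcomp Require Import all_boot all_order all_algebra.
From mathcomp Require Import all_classical all_reals all_analysis.
From mathcomp Require Import generic_quotient wochoice.
Local Open Scope classical_set_scope.
Local Open Scope card_scope.

(* Let p be the collapsed point.  Each coordinate x < kappa gives a basic
   neighbourhood U_x of p on which the large cube satisfies f(x) = 0; since a basic
   set fixes finitely many coordinates, x |-> U_x is finite-to-one.  The trace of U_x
   on the small cube contains a cylinder determined by one of only lambda finite
   sets, so many U_x contain the same cylinder: kappa many when lambda < cf kappa,
   and mu many for every mu < kappa in any case.  A basic set inside that cylinder
   then has that many supersets.

   Conversely, given h : kappa -> lambda, take the cylinders missing p together
   with the unions of {f = 0 on t} and {g = 0 on s} with h(t) included in s.  This
   base has size kappa, hence is (kappa^+)^op-like.  A cylinder of the small cube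
   with zero set a only lies in unions with t inside the preimage of a under h, so
   the base is kappa^op-like as soon as the fibres of h are smaller than kappa;
   composing a map onto a cofinal set with an embedding in lambda gives such an h when
   cf kappa <= lambda. *)

Set Implicit Arguments.
Unset Strict Implicit.
Unset Printing Implicit Defensive.

(** * Cardinal arithmetic *)

Lemma card_le_inj (T U : Type) (A : set T) (B : set U) (f : T -> U) :
  (forall x, A x -> B (f x)) ->
  (forall x y, A x -> A y -> f x = f y -> x = y) -> A #<= B.
Proof.
move=> fB fI.
suff /injfunPex[g] : exists2 f : T -> U, set_fun A B f & set_inj A f.
  exact: inj_card_le.
exists f => // x y /set_mem Ax /set_mem Ay; exact: fI.
Qed.

Lemma card_le_exinj (T U : Type) (A : set T) (B : set U) (u0 : U) :
  A #<= B -> exists2 f : T -> U, (forall x, A x -> B (f x)) &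
    (forall x y, A x -> A y -> f x = f y -> x = y).
Proof.
move=> /card_leP[f].
have /injfunPex[g gB gI] : $|{injfun A >-> B}| by squash (valLR u0 f).
by exists g => // x y Ax Ay; apply: gI; apply/mem_set.
Qed.

Lemma card_le_nonempty (T U : Type) (A : set T) (B : set U) :
  A !=set0 -> A #<= B -> B !=set0.
Proof.
move=> [x Ax] AB; apply: contrapT => /set0P/negP/negPn/eqP B0.
by move: AB; rewrite B0 => /card_le0P A0; move: Ax; rewrite A0.
Qed.

(** * Well-orderings and comparability of cardinals *)

Definition well_ordering (T : Type) (R : T -> T -> Prop) :=
  [/\ well_founded R, (forall x y z, R x y -> R y z -> R x z) &
      (forall x y, [\/ R x y, x = y | R y x])].

Lemma ex_well_ordering (T : Type) :
  exists R : T -> T -> Prop, well_ordering R.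
Proof.
have [W Wwo] := @well_ordering_principle {classic T}.
have minW (A : {pred {classic T}}) : nonempty A -> exists z, minimum_of W A z.
  by move=> /Wwo[z [zm _]]; exists z.
have wcW : @wo_chain {classic T} W predT by move=> A _; exact: Wwo.
have tot : forall x y : {classic T}, W x y || W y x.
  by move=> x y; apply: (wo_chainW wcW).
have anti : forall x y : {classic T}, W x y -> W y x -> x = y.
  by move=> x y xy yx; apply: (wo_chain_antisymmetric wcW) => //; apply/andP.
have min3 (A : {classic T} -> Prop) (x : {classic T}) : A x ->
    exists2 z, A z & forall y, A y -> W z y.
  move=> Ax; have [|z [zA zm]] := @minW [pred x | `[< A x >]].
    by exists x; apply/asboolP.
  exists z; first exact/asboolP.
  by move=> y Ay; apply: zm; apply/asboolP.
exists (fun x y => W x y /\ x <> y); split.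
- move=> x; apply: contrapT => nx.
  have [z nz zm] := min3 (fun x => ~ Acc (fun x y => W x y /\ x <> y) x) _ nx.
  apply: nz; constructor => y [Wyz yz]; apply: contrapT => ny.
  by apply: yz; apply: anti => //; exact: zm.
- move=> x y z [xy xNy] [yz yNz].
  (* Transitivity is read off the minimum of [x], [y], [z]: if it were [y] or [z], antisymmetry
     would contradict a strict inequality. *)
  have [m mE mm] := min3 (fun t => t = x \/ t = y \/ t = z) x (or_introl erefl).
  case: mE mm => [->|[->|->]] mm.
  + split; first exact: mm (or_intror (or_intror erefl)).
    by move=> xz; apply: xNy; apply: anti; rewrite // xz.
  + by case: xNy; apply: anti => //; exact: mm (or_introl erefl).
  + by case: yNz; apply: anti => //; exact: mm (or_intror (or_introl erefl)).
- move=> x y; case: (pselect (x = y)) => [|xy]; first by constructor 2.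
  have /orP[] := tot x y; first by constructor 1.
  by constructor 3; split => // /esym.
Qed.

Definition seg_in (T : Type) (R : T -> T -> Prop) (D : set T) (x : T) : set T :=
  [set y | D y /\ R y x].

Lemma wf_min (T : Type) (R : T -> T -> Prop) (A : T -> Prop) (x : T) :
  well_founded R -> A x -> exists2 z, A z & forall y, R y z -> ~ A y.
Proof.
move=> wf; elim/(well_founded_ind wf): x => x IH Ax.
case: (pselect (exists2 y, R y x & A y)) => [[y yx Ay]|nex]; first exact: IH Ay.
by exists x => // y yx Ay; apply: nex; exists y.
Qed.

(** Proper segments are indexed by their endpoints, so a least endpoint can be taken. With [P] a
    condition on size, this produces initial ordinals. *)
Lemma min_initial_segment (T : Type) (R : T -> T -> Prop) (A : set T)
    (P : set T -> Prop) : well_ordering R -> P A ->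
  exists D, [/\ D `<=` A, P D & forall x, D x -> ~ P (seg_in R D x)].
Proof.
move=> [wf tr tri] PA.
case: (pselect (exists x, A x /\ P (seg_in R A x))) => [[x Px]|nex]; last first.
  by exists A; split => // x Ax Px; apply: nex; exists x.
have [z [Az Pz] zm] := @wf_min _ _ (fun x => A x /\ P (seg_in R A x)) x wf Px.
exists (seg_in R A z); split => //; first by move=> y [].
move=> y [Ay yz] Py; apply: (zm y yz); split => //.
suff -> : seg_in R A y = seg_in R (seg_in R A z) y by [].
apply/seteqP; split => t; last by move=> [[]].
by move=> [At ty]; do ![split => //]; exact: tr yz.
Qed.

(* Greedy recursion: [F x] is any element of [B] not used below [x]. *)
Lemma wf_card_le (T U : Type) (R : T -> T -> Prop) (D : set T) (B : set U) :
  well_founded R -> (forall x y, [\/ R x y, x = y | R y x]) ->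
  (forall x, D x -> ~ (B #<= seg_in R D x)) -> D #<= B.
Proof.
(* [get] needs a pointed type; over an empty [U] the hypothesis [small] already empties [D]. *)
move=> wf tri; elim/Ppointed: U => U in B * => small.
  rewrite (_ : D = set0) ?card_ge0 // -subset0 => x Dx; apply: (small x Dx).
  by rewrite emptyE.
pose F := Fix wf (fun _ => U) (fun x rec =>
  get [set u | B u /\ ~ exists y (yx : R y x), D y /\ rec y yx = u]).
have FE x : F x = get [set u | B u /\ ~ exists y (yx : R y x), D y /\ F y = u].
  rewrite /F Fix_eq // => {}x f g fg; congr get.
  apply/seteqP; split=> u [Bu nu]; split => // -[y [yx [Dy e]]]; apply: nu;
    by exists y, yx; rewrite ?fg // -fg.
have FP x : D x -> B (F x) /\ ~ exists y (yx : R y x), D y /\ F y = F x.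
  move=> Dx; suff : [set u | B u /\ ~ exists y (yx : R y x), D y /\ F y = u] (F x) by [].
  rewrite FE; apply: getPex; apply: contrapT => nex; apply: (small x Dx).
  (* If no element of [B] were left, [F] would map the segment onto [B]. *)
  apply: (card_le_trans (B := F @` seg_in R D x)); last exact: card_image_le.
  apply: subset_card_le => u Bu; apply: contrapT => nu; apply: nex.
  by exists u; split => // -[y [yx [Dy e]]]; apply: nu; exists y.
apply: (@card_le_inj _ _ _ _ F) => [x /FP[]//|x y Dx Dy e].
by case: (tri x y) => // r; [case: (FP y Dy)|case: (FP x Dx)] => _ []; eexists; exists r.
Qed.

(** The greedy injection of [A] into [B] fails only when [B] embeds in a proper segment of [A]. *)
Lemma card_le_total (T U : Type) (A : set T) (B : set U) : A #<= B \/ B #<= A.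
Proof.
have [R [wf tr tri]] := ex_well_ordering T.
case: (pselect (exists2 x, A x & B #<= seg_in R A x)) => [[x Ax le]|nex].
  by right; apply: card_le_trans le _; apply: subset_card_le => y [].
by left; apply: (wf_card_le wf tri) => x Ax le; apply: nex; exists x.
Qed.

Lemma card_leX (T T' U U' : Type) (A : set T) (A' : set T') (B : set U)
    (B' : set U') : A #<= A' -> B #<= B' -> A `*` B #<= A' `*` B'.
Proof.
case: (pselect (A `*` B !=set0)) => [[[a b] [/= Aa Bb]]|]; last first.
  by move=> /set0P/negP/negPn/eqP -> _ _; exact: card_ge0.
move=> AA BB.
have [a' _] := card_le_nonempty (ex_intro _ _ Aa) AA.
have [b' _] := card_le_nonempty (ex_intro _ _ Bb) BB.
have [f fA fI] := card_le_exinj a' AA; have [g gB gI] := card_le_exinj b' BB.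
apply: (@card_le_inj _ _ _ _ (fun p => (f p.1, g p.2))).
  by move=> [x y] [/= Ax By]; split; [exact: fA|exact: gB].
by move=> [x y] [z t] [/= Ax By] [/= Az Bt] [/fI -> // /gI ->].
Qed.

Lemma card_le_infinite (T U : Type) (A : set T) (B : set U) :
  A #<= B -> infinite_set A -> infinite_set B.
Proof. by move=> AB Ai Bf; apply: Ai; exact: card_le_finite AB Bf. Qed.

Lemma infinite_ex2 (T : Type) (A : set T) : infinite_set A ->
  exists a b, [/\ A a, A b & a <> b].
Proof.
move=> Ai; have [a Aa] := infinite_setN0 Ai.
have [b [Ab /= ab]] := infinite_setN0 (infinite_setD Ai (finite_set1 a)).
by exists a, b; split => // e; apply: ab.
Qed.

(* Hessenberg's theorem.  A minimal counterexample [D] is an initial ordinal;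
   under the max-lexicographic order every proper segment of [D `*` D] lies in
   the square of a segment of [D], hence is smaller than [D]. *)
Theorem infinite_card_leX (T : Type) (A : set T) :
  infinite_set A -> A `*` A #<= A.
Proof.
move=> Ai; apply: contrapT => nsq.
have [R woR] := ex_well_ordering T.
have [D [_ [Di Dn] Dmin]] := min_initial_segment
  (P := fun D => infinite_set D /\ ~ (D `*` D #<= D)) woR (conj Ai nsq).
have {}Dmin x : D x -> infinite_set (seg_in R D x) ->
    seg_in R D x `*` seg_in R D x #<= seg_in R D x.
  by move=> Dx xi; apply: contrapT => xn; exact: (Dmin x Dx).
have segD x : seg_in R D x #<= D by apply: subset_card_le => y [].
apply: Dn; case: (pselect (exists2 x, D x & D #<= seg_in R D x)) => [[x Dx le]|nex].
  apply: card_le_trans (segD x); apply: card_le_trans (card_leX le le) _.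
  by apply: Dmin => //; exact: card_le_infinite le Di.
have {}nex x : D x -> ~ (D #<= seg_in R D x) by move=> Dx le; apply: nex; exists x.
case: woR => wf tr tri.
pose mx x y := if pselect (R x y) then y else x.
have mxl x y : x = mx x y \/ R x (mx x y).
  by rewrite /mx; case: pselect; [right|left].
have mxr x y : y = mx x y \/ R y (mx x y).
  rewrite /mx; case: pselect => [r|n]; first by left.
  by case: (tri x y) => //; [left|right].
have mxD x y : D x -> D y -> D (mx x y) by rewrite /mx; case: pselect.
pose L := slexprod T (T * T) R (slexprod T T R R).
(* The pair itself is the second component, so that ties between maxima are broken and the order is
   total. *)
pose R2 (p q : T * T) := L (mx p.1 p.2, p) (mx q.1 q.2, q).
have wfL : well_founded L.
  exact: (@wf_slexprod _ _ _ _ wf (@wf_slexprod _ _ _ _ wf wf)).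
have wf2 : well_founded R2 by exact: (wf_inverse_image _ _ L (fun p => (mx p.1 p.2, p))).
have triL (S1 S2 : Type) (P1 : S1 -> S1 -> Prop) (P2 : S2 -> S2 -> Prop) :
    (forall x y, [\/ P1 x y, x = y | P1 y x]) ->
    (forall x y, [\/ P2 x y, x = y | P2 y x]) ->
    forall p q, [\/ slexprod S1 S2 P1 P2 p q, p = q | slexprod S1 S2 P1 P2 q p].
  move=> h1 h2 [a b] [c d]; case: (h1 a c) => [r|->|r].
  - by constructor 1; exact: left_slex.
  - case: (h2 b d) => [r|->|r]; first by constructor 1; exact: right_slex.
    + by constructor 2.
    + by constructor 3; exact: right_slex.
  - by constructor 3; exact: left_slex.
have tri2 p q : [\/ R2 p q, p = q | R2 q p].
  case: (triL _ _ _ _ tri (triL _ _ _ _ tri tri) (mx p.1 p.2, p) (mx q.1 q.2, q)).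
  - by constructor 1.
  - by case=> _; constructor 2.
  - by constructor 3.
apply: (wf_card_le wf2 tri2) => -[a b] [/= Da Db] le.
pose z := mx a b; have Dz : D z by exact: mxD.
pose S := seg_in R D z; pose S' := z |` S.
(* A pair below [(a, b)] has maximum at most [z], so both coordinates lie in [S']. *)
have le' : D #<= S' `*` S'.
  apply: card_le_trans le _; apply: subset_card_le => -[x y] [[/= Dx Dy] lt].
  have mz : mx x y = z \/ R (mx x y) z by inversion lt; [right|left].
  suff cl t : D t -> t = mx x y \/ R t (mx x y) -> S' t.
    by split; apply: cl.
  move=> Dt; case: mz => [-> |mz] [e|r].
  - by left.
  - by right.
  - by right; split => //; rewrite e.
  - by right; split => //; exact: tr mz.
case: (pselect (finite_set S)) => [Sf|Si].
  have S'f : finite_set S' by rewrite finite_setU; split => //; exact: finite_set1.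
  by apply: Di; apply: card_le_finite le' _; exact: finite_setX.
have sq := Dmin z Dz Si; rewrite -/S in sq.
apply: (nex z Dz); apply: card_le_trans le' _.
suff S'S : S' #<= S by apply: card_le_trans (card_leX S'S S'S) sq.
(* Points of [S] are tagged by [u], and the extra point goes to [(u, v)], which no tagged point
   equals. *)
have [u [v [Su Sv uv]]] := infinite_ex2 Si.
apply: card_le_trans sq.
apply: (@card_le_inj _ _ _ _ (fun x => if pselect (S x) then (x, u) else (u, v))).
  by move=> x _; case: pselect.
move=> x y [->|Sx] [->|Sy]; do 2 case: pselect => //; try by move=> ? ? [].
all: by move=> ? ? [] // _ /esym.
Qed.

Lemma card_le_sqr (T T' U : Type) (A : set T) (A' : set T') (B : set U) :
  infinite_set B -> A #<= B -> A' #<= B -> A `*` A' #<= B.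
Proof.
by move=> Bi AB A'B; apply: card_le_trans (card_leX AB A'B) (infinite_card_leX Bi).
Qed.

Lemma card_leU (T U : Type) (A A' : set T) (B : set U) :
  infinite_set B -> A #<= B -> A' #<= B -> A `|` A' #<= B.
Proof.
move=> Bi AB AB'; have [u [v [Bu Bv uv]]] := infinite_ex2 Bi.
have [f fB fI] := card_le_exinj u AB; have [g gB gI] := card_le_exinj u AB'.
apply: card_le_trans (infinite_card_leX Bi).
apply: (@card_le_inj _ _ _ _ (fun x => if pselect (A x) then (f x, u) else (g x, v))).
  move=> x xAA; case: pselect => [Ax|nAx]; first by split => //; exact: fB.
  by case: xAA => // A'x; split => //; exact: gB.
move=> x y xAA yAA; case: pselect => Ax; case: pselect => Ay.
- by case=> e; exact: fI.
- by case=> _ /uv.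
- by case=> _ /esym /uv.
- by case: xAA yAA => // A'x [//|A'y] [e]; exact: gI.
Qed.

(** The larger part absorbs the smaller if it is infinite; if it is finite, so is the union. *)
Lemma not_card_leU (T U : Type) (B : set U) (A A' : set T) :
  infinite_set B -> ~ (B #<= A) -> ~ (B #<= A') -> ~ (B #<= A `|` A').
Proof.
wlog le : A A' / A #<= A'.
  move=> H Bi nA nA'; case: (card_le_total A A') => le; first exact: H.
  by rewrite setUC; exact: H.
move=> Bi nA nA' BU; case: (pselect (finite_set A')) => [fA'|iA'].
  apply: Bi; apply: card_le_finite BU _; rewrite finite_setU; split => //.
  exact: card_le_finite le fA'.
by apply: nA'; apply: card_le_trans BU _; apply: card_leU.
Qed.

Lemma finite_card_le (T U : Type) (A : set T) (B : set U) :
  infinite_set B -> finite_set A -> A #<= B.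
Proof.
move=> Bi Af; apply: (card_le_trans (B := [set: nat])).
  exact: finite_set_countable.
exact/infiniteP.
Qed.

Lemma card_le_fibers (T V U : Type) (A : set T) (f : T -> V) (B : set U) :
  infinite_set B -> f @` A #<= B -> (forall v, A `&` f @^-1` [set v] #<= B) ->
  A #<= B.
Proof.
move=> Bi fAB fib; have [u Bu] := infinite_setN0 Bi.
have /choice[g gP] v : exists g : T -> U,
    (forall x, (A `&` f @^-1` [set v]) x -> B (g x)) /\
    (forall x y, (A `&` f @^-1` [set v]) x -> (A `&` f @^-1` [set v]) y ->
      g x = g y -> x = y).
  by have [g gB gI] := card_le_exinj u (fib v); exists g.
apply: card_le_trans (card_le_sqr Bi fAB (card_lexx B)).
apply: (@card_le_inj _ _ _ _ (fun x => (f x, g (f x) x))).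
  by move=> x Ax; split => /=; [exists x|apply: (gP (f x)).1].
by move=> x y Ax Ay [e]; rewrite -e; apply: (gP (f x)).2.
Qed.

(** The fibres being finite, the image is infinite, and [card_le_fibers] applies with the image
    itself as bound. *)
Lemma card_ge_image_finite_fibers (T V : Type) (A : set T) (f : T -> V) :
  infinite_set A -> (forall v, finite_set (A `&` f @^-1` [set v])) ->
  A #<= f @` A.
Proof.
move=> Ai fib.
have Bi : infinite_set (f @` A).
  move=> fin; apply: Ai.
  have -> : A = \bigcup_(v in f @` A) (A `&` f @^-1` [set v]).
    apply/seteqP; split => x; last by move=> [v _ []].
    by move=> Ax; exists (f x) => //; exists x.
  by apply: bigcup_finite => // v _; exact: fib.
apply: (@card_le_fibers _ _ _ _ f) => // v.
exact: finite_card_le.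
Qed.

(** Counts families whose members are named, perhaps not uniquely, by two parameters, such as the
    zeros and ones of a cylinder. *)
Lemma card_image2_le (S T V U : Type) (g : S -> T -> V) (A : set S) (A' : set T)
    (B : set U) (F : set V) : infinite_set B -> A #<= B -> A' #<= B ->
  (forall v, F v -> exists s t, [/\ A s, A' t & v = g s t]) -> F #<= B.
Proof.
move=> Bi AB AB' FE; apply: card_le_trans (card_le_sqr Bi AB AB').
apply: card_le_trans (card_image_le (fun p => g p.1 p.2) _).
by apply: subset_card_le => v /FE[s [t [As At ->]]]; exists (s, t).
Qed.

(** * Finite sequences over an infinite set *)

Definition seqs (T : Type) (A : set T) : set (seq T) :=
  [set s | forall x, List.In x s -> A x].

Lemma card_le_seqs (T U : Type) (A : set T) (B : set U) :
  infinite_set B -> A #<= B -> seqs A #<= B.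
Proof.
move=> Bi AB; have [u Bu] := infinite_setN0 Bi.
have [f fB fI] := card_le_exinj u AB.
have [p pB pI] := card_le_exinj u (infinite_card_leX Bi).
have [n nB nI] := card_le_exinj u ((infiniteP _).1 Bi).
pose code := foldr (fun x r => p (f x, r)) u.
have codeB s : seqs A s -> B (code s).
  elim: s => //= x s IH As; apply: pB; split => /=.
    by apply: fB; apply: As; left.
  by apply: IH => y ys; apply: As; right.
(* The length is recorded because [code] may confuse the end marker [u] with the code of a nonempty
   sequence. *)
apply: (@card_le_inj _ _ _ _ (fun s => p (n (size s), code s))).
  by move=> s As; apply: pB; split => /=; [exact: nB|exact: codeB].
have pI' x y z t : B x -> B y -> B z -> B t -> p (x, y) = p (z, t) -> x = z /\ y = t.
  by move=> Bx By Bz Bt e; have [-> ->] := pI (x, y) (z, t) (conj Bx By) (conj Bz Bt) e.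
move=> s t As At /pI'[] //; do ?[exact: nB|exact: codeB].
move=> /(nI _ _ I I); elim: s t As At => [|x s IH] [|y t] //= As At [e].
have As' : seqs A s by move=> z zs; apply: As; right.
have At' : seqs A t by move=> z zs; apply: At; right.
have Ax : A x by apply: As; left.
have Ay : A y by apply: At; left.
move=> /pI'[]; do ?[exact: fB|exact: codeB].
by move=> /fI -> // /IH ->.
Qed.

Lemma finite_In (T : Type) (s : seq T) : finite_set [set x | List.In x s].
Proof.
elim: s => [|x s IH]; first exact: finite_set0.
rewrite (_ : [set _ | _] = [set x] `|` [set y | List.In y s]).
  by rewrite finite_setU; split => //; exact: finite_set1.
by apply/seteqP; split => y /= [e|]; [left|right|left|right].
Qed.

(** * Initial well-orders and successor cardinals *)

Lemma ex_initial_wellorder (K : Type) : exists R : K -> K -> Prop, initial_wellorder R.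
Proof.
have [R woR] := ex_well_ordering K.
(* [D] is a shortest segment receiving [K]; a segment of the pulled-back order as large as [K] would
   put [K] into a proper segment of [D]. *)
have [D [_ KD Dmin]] := min_initial_segment
  (P := fun D => [set: K] #<= D) woR (card_lexx _).
case: (pselect (exists k : K, True)) => [[k _]|nK]; last first.
  by exists R; case: woR => *; split => // x; case: nK; exists x.
have [f fD fI] := card_le_exinj k KD; case: woR => wf tr tri.
exists (fun x y => R (f x) (f y)); split.
- exact: (wf_inverse_image _ _ R f).
- by move=> x y z; exact: tr.
- move=> x y; case: (tri (f x) (f y)) => [|/fI e|]; first by constructor 1.
  + by constructor 2; exact: e.
  + by constructor 3.
- move=> x; split; first exact: card_leT.
  move=> le; apply: (Dmin (f x)); first exact: fD.
  apply: card_le_trans le _; apply: (@card_le_inj _ _ _ _ f) => [y /= yx|y z _ _].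
    by split => //; exact: fD.
  exact: fI.
Qed.

Lemma not_card_le_powerset (K : Type) : ~ ([set: set K] #<= [set: K]).
Proof.
move=> le; case: (pselect (exists k : K, True)) => [[k _]|nK]; last first.
  have [x _] := card_le_nonempty (ex_intro [set: set K] set0 I) le.
  by apply: nK; exists x.
have [f _ fI] := card_le_exinj k le.
pose Dg := [set x | exists2 A, f A = x & ~ A x].
have n : ~ Dg (f Dg) by move=> /[dup] d [A e]; rewrite (fI _ _ I I e).
by apply: (n); exists Dg.
Qed.

(** Take a shortest segment of the well-ordered power set that does not embed in [K]. Its proper
    segments embed in [K], so the greedy recursion puts it into any larger [N]. *)
Lemma ex_succ_card (K : Type) : exists P : Type, is_succ_card K P.
Proof.
have [R woR] := ex_well_ordering (set K).
have [D [_ nD Dmin]] := min_initial_segment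
  (P := fun D => ~ (D #<= [set: K])) woR (@not_card_le_powerset K).
case: (woR) => wf tr tri; exists D; split.
  split; last by rewrite (card_le_eql (card_setT D)).
  by rewrite (card_le_eqr (card_setT D)); case: (card_le_total [set: K] D).
move=> N [_ nNK]; rewrite (card_le_eql (card_setT D)).
apply: (wf_card_le wf tri) => x Dx Nx; apply: nNK; apply: card_le_trans Nx _.
by apply: contrapT; exact: Dmin.
Qed.

(** * Cylinders in Cantor cubes *)

(** The lists of zeros and ones may conflict, which makes the set empty; hence the nonemptiness
    hypotheses below. *)
Definition cyl (T : Type) (a b : seq T) : set (T -> bool) :=
  [set f | (forall x, List.In x a -> f x = false) /\
           (forall x, List.In x b -> f x = true)].

Lemma open_ptwsP (T : Type) (A : set (T -> bool)) :
  open (A : set {ptws T -> bool}) <->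
  forall f, A f -> exists s : seq T,
    forall g, (forall x, List.In x s -> g x = f x) -> A g.
Proof.
split=> [oA f Af|cA].
  (* The filter of sets containing a cylinder around [f] converges to [f] in each coordinate, hence
     in the product. *)
  pose F : set_system (T -> bool) := [set B | exists s : seq T,
    forall g, (forall x, List.In x s -> g x = f x) -> B g].
  have FF : Filter F.
    split.
    - by exists [::].
    - move=> P Q [s Ps] [t Qt]; exists (s ++ t) => g gf.
      by split; [apply: Ps|apply: Qt] => x xs; apply: gf; apply/List.in_app_iff; [left|right].
    - by move=> P Q PQ [s Ps]; exists s => g /Ps /PQ.
  have : {ptws, F --> f}.
    apply/cvg_sup => t B [_ [[W oW <-] Wft WB]].
    by exists [:: t] => g /(_ t (or_introl erefl)) gt; apply: WB; rewrite /= gt.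
  by move/(_ A); apply; apply: open_nbhs_nbhs.
rewrite openE => f Af; have [s sA] := cA f Af.
rewrite /interior; apply: filterS sA _; elim: s => [|x s IH].
  by apply: filterS filterT => g _ x [].
have : nbhs (f : {ptws T -> bool}) [set g : {ptws T -> bool} | g x = f x].
  apply: (@proj_continuous {classic T} (fun _ => bool) x f [set b | b = f x]).
  by rewrite nbhs_principalE; apply/principal_filterP.
move: IH; apply: filterS2 => g gs gx y [<-|] //; exact: gs.
Qed.

Lemma open_cyl (T : Type) (a b : seq T) : open (cyl a b : set {ptws T -> bool}).
Proof.
apply/open_ptwsP => f [fa fb]; exists (a ++ b) => g gf; split => x xs.
  by rewrite gf ?fa //; apply/List.in_app_iff; left.
by rewrite gf ?fb //; apply/List.in_app_iff; right.
Qed.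

(** The last clause leaves [b] empty when [f] is the zero point. *)
Lemma cyl_nbhs (T : Type) (A : set (T -> bool)) (f : T -> bool) :
  open (A : set {ptws T -> bool}) -> A f ->
  exists a b, [/\ cyl a b f, cyl a b `<=` A &
    (forall x, List.In x b -> f x = true)].
Proof.
move=> /open_ptwsP /[apply] -[s sA].
exists (List.filter (fun x => ~~ f x) s), (List.filter f s); split.
- by split=> x /List.filter_In[_] // /negbTE.
- move=> g [g0 g1]; apply: sA => x xs; case fx: (f x).
    by apply: g1; apply/List.filter_In.
  by apply: g0; apply/List.filter_In; rewrite fx.
- by move=> x /List.filter_In[].
Qed.

(** Setting a coordinate off [a] to one, or a coordinate off [b] to zero, keeps a point in the
    smaller cylinder, so every outer constraint is already imposed there. *)
Lemma cyl_sub (T : Type) (a b a' b' : seq T) :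
  cyl a b !=set0 -> cyl a b `<=` cyl a' b' ->
  (forall x, List.In x a' -> List.In x a) /\
  (forall x, List.In x b' -> List.In x b).
Proof.
move=> [f fab] sub; have [fa fb] := fab; have [fa' fb'] := sub _ fab.
pose g (x : T) v (y : T) : bool := if pselect (y = x) then v else f y.
have gxx x v : g x v x = v by rewrite /g; case: pselect.
split=> x xs; apply: contrapT => nx.
- have [/(_ x xs)] : cyl a' b' (g x true); last by rewrite gxx.
  apply: sub; split=> y ys; rewrite /g; case: pselect => // e; last exact: fb.
  + by rewrite e in ys.
  + exact: fa.
- have [_ /(_ x xs)] : cyl a' b' (g x false); last by rewrite gxx.
  apply: sub; split=> y ys; rewrite /g; case: pselect => // e; first exact: fa.
  + by rewrite e in ys.
  + exact: fb.
Qed.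

Definition zero (T : Type) : T -> bool := fun=> false.

Lemma cyl_nonzero (T : Type) (a b : seq T) : b <> [::] -> ~ cyl a b (@zero T).
Proof. by case: b => // x b _ [_ /(_ x (or_introl erefl))]. Qed.

Lemma ex_nonzero (T : Type) (f : T -> bool) : f <> @zero T -> exists x, f x = true.
Proof.
move=> f0; apply: contrapT => nf; apply: f0; apply/funext => x.
by case fx: (f x) => //; case: nf; exists x.
Qed.

(** Adding to [b] a coordinate where [f] is one makes the cylinder miss the zero point. *)
Lemma cyl_nbhs_nonzero (T : Type) (A : set (T -> bool)) (f : T -> bool) :
  open (A : set {ptws T -> bool}) -> A f -> f <> @zero T ->
  exists a b, [/\ b <> [::], cyl a b f & cyl a b `<=` A].
Proof.
move=> oA Af /ex_nonzero[x fx]; have [a [b [[fa fb] abA _]]] := cyl_nbhs oA Af.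
exists a, (x :: b); split=> //; first by split=> // y [<-|/fb].
by move=> g [ga gb]; apply: abA; split=> // y yb; apply: gb; right.
Qed.

Lemma cyl_nbhs_zero (T : Type) (A : set (T -> bool)) :
  open (A : set {ptws T -> bool}) -> A (@zero T) ->
  exists a, cyl a [::] `<=` A.
Proof.
move=> oA A0; have [a [b [_ abA b0]]] := cyl_nbhs oA A0.
by exists a => g [ga _]; apply: abA; split=> // x /b0.
Qed.

(** Used to shrink [cyl a [::]] to a nonempty cylinder missing the zero point, which stays open in
    the quotient. *)
Lemma ex_cyl_one (T : Type) (a : seq T) : infinite_set [set: T] ->
  exists2 l, ~ List.In l a & cyl a [:: l] !=set0.
Proof.
move=> Li; have [l [_ /= la]] := infinite_setN0 (infinite_setD Li (finite_In a)).
exists l => //; exists (fun x => `[< x = l >]); split=> x.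
  by move=> xa; apply/asboolPn => e; apply: la; rewrite -e.
by case=> // <-; apply/asboolP.
Qed.

(** * The quotient space and its base *)

Section CollapsedSum.
Variables K L : Type.
Local Notation Y := (Yspace K L).
Local Open Scope quotient_scope.

Definition inK (f : K -> bool) : Y := \pi_(Yquot K L) (existT (cube K L) true f).
Definition inL (g : L -> bool) : Y := \pi_(Yquot K L) (existT (cube K L) false g).

(** A total projection, with a default value on the other summand, avoids inverting an equality of
    dependent pairs. *)
Lemma existT_cubeK (f g : K -> bool) :
  existT (cube K L) true f = existT (cube K L) true g -> f = g.
Proof.
pose pr (z : dsum K L) : K -> bool :=
  match z with existT b h => (if b return cube K L b -> K -> bool
    then fun h => h else fun _ => @zero K) h end.
by move=> /(congr1 pr).
Qed.

Lemma existT_cubeL (f g : L -> bool) :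
  existT (cube K L) false f = existT (cube K L) false g -> f = g.
Proof.
pose pr (z : dsum K L) : L -> bool :=
  match z with existT b h => (if b return cube K L b -> L -> bool
    then fun _ => @zero L else fun h => h) h end.
by move=> /(congr1 pr).
Qed.

Lemma inK_inj : injective inK.
Proof.
move=> f g /eqmodP /orP[/eqP/existT_cubeK //|/andP[]].
by case/orP=> /eqP // /existT_cubeK -> /orP[/eqP/existT_cubeK ->|/eqP].
Qed.

Lemma inL_inj : injective inL.
Proof.
move=> f g /eqmodP /orP[/eqP/existT_cubeL //|/andP[]].
by case/orP=> /eqP // /existT_cubeL -> /orP[/eqP|/eqP/existT_cubeL ->].
Qed.

Lemma inK0 : inK (@zero K) = inL (@zero L).
Proof. by apply/eqmodP; rewrite /= /collapse !eqxx !orbT. Qed.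

Lemma inKL (f : K -> bool) (g : L -> bool) :
  inK f = inL g -> f = @zero K /\ g = @zero L.
Proof.
move=> /eqmodP /orP[/eqP //|/andP[]].
by case/orP=> /eqP // /existT_cubeK -> /orP[/eqP|/eqP/existT_cubeL ->].
Qed.

Lemma Y_cover (y : Y) : (exists f, y = inK f) \/ (exists g, y = inL g).
Proof.
elim/quotW: y => -[[] f]; [left|right]; by exists f.
Qed.

Lemma openYP (U : set Y) : open U <->
  open (inK @^-1` U : set {ptws K -> bool}) /\
  open (inL @^-1` U : set {ptws L -> bool}).
Proof.
have -> : open U <-> open (\pi_(Yquot K L) @^-1` U : set (dsum K L)) by [].
rewrite sigT_openP; split=> [oU|[oK oL] i]; last by case: i.
by split; [exact: (oU true)|exact: (oU false)].
Qed.

(** These are the basic neighbourhoods of the collapsed point. *)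
Definition star (t : seq K) (s : seq L) : set Y :=
  inK @` cyl t [::] `|` inL @` cyl s [::].

Lemma inK_star t s : inK @^-1` star t s = cyl t [::].
Proof.
apply/seteqP; split=> f; last by move=> ft; left; exists f.
by case=> -[g gc]; [move=> /inK_inj <-|move=> /esym/inKL[-> _]].
Qed.

Lemma inL_star t s : inL @^-1` star t s = cyl s [::].
Proof.
apply/seteqP; split=> f; last by move=> ft; right; exists f.
by case=> -[g gc]; [move=> /inKL[_ ->]|move=> /inL_inj <-].
Qed.

Lemma open_star t s : open (star t s).
Proof. by apply/openYP; rewrite inK_star inL_star; split; exact: open_cyl. Qed.

(** Since [b] is nonempty, the cylinder misses the collapsed point, so its trace on the other cube
    is empty. *)
Lemma open_inK_cyl a b : b <> [::] -> open (inK @` cyl a b).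
Proof.
move=> b0; apply/openYP; split.
  rewrite (_ : _ @^-1` _ = cyl a b); first exact: open_cyl.
  by apply/seteqP; split=> f; [move=> [g gc /inK_inj <-]|exists f].
rewrite (_ : _ @^-1` _ = set0); first exact: open0.
by rewrite -subset0 => g [f + /inKL[f0 _]]; rewrite f0 => /cyl_nonzero; apply.
Qed.

Lemma open_inL_cyl a b : b <> [::] -> open (inL @` cyl a b).
Proof.
move=> b0; apply/openYP; split; last first.
  rewrite (_ : _ @^-1` _ = cyl a b); first exact: open_cyl.
  by apply/seteqP; split=> f; [move=> [g gc /inL_inj <-]|exists f].
rewrite (_ : _ @^-1` _ = set0); first exact: open0.
by rewrite -subset0 => g [f + /esym/inKL[_ f0]]; rewrite f0 => /cyl_nonzero; apply.
Qed.

(** * A base coupled by a map of coordinates *)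

Definition baseK : set (set Y) :=
  [set W | exists a b, [/\ b <> [::], cyl a b !=set0 & W = inK @` cyl a b]].
Definition baseL : set (set Y) :=
  [set W | exists a b, [/\ b <> [::], cyl a b !=set0 & W = inL @` cyl a b]].
Definition base0 (h : K -> L) : set (set Y) :=
  [set W | exists t s, (forall x, List.In x t -> List.In (h x) s) /\ W = star t s].
Definition base (h : K -> L) := baseK `|` baseL `|` base0 h.

Lemma base_basis h : basis (base h).
Proof.
split.
  move=> W [[[a [b [b0 _ ->]]]|[a [b [b0 _ ->]]]]|[t [s [_ ->]]]].
  - exact: open_inK_cyl.
  - exact: open_inL_cyl.
  - exact: open_star.
move=> y A; rewrite nbhsE => -[U [/openYP[oK oL] Uy] UA].
suff [W [bW Wy WU]] : exists W, [/\ base h W, W y & W `<=` U].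
  by exists W => //; exact: subset_trans UA.
have zeroC : y = inK (@zero K) -> exists W, [/\ base h W, W y & W `<=` U].
  move=> y0; have [|t tU] := cyl_nbhs_zero oK; first by rewrite /= -y0.
  have [|s sU] := cyl_nbhs_zero oL; first by rewrite /= -inK0 -y0.
  (* Enlarging [s] by the images of [t] meets the coupling and only shrinks the neighbourhood. *)
  exists (star t (s ++ List.map h t)); split.
  - right; exists t, (s ++ List.map h t); split=> // x xt.
    by apply/List.in_app_iff; right; exact: List.in_map.
  - by rewrite y0; left; exists (@zero K).
  - move=> _ [[f /tU ? <-]//|[g [gs _] <-]]; apply: sU; split=> // x xs.
    by apply: gs; apply/List.in_app_iff; left.
case: (Y_cover y) => -[f yf].
- case: (pselect (f = @zero K)) => [f0|f0]; first by apply: zeroC; rewrite yf f0.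
  have [|a [b [b0 fab abU]]] := cyl_nbhs_nonzero oK _ f0; first by rewrite /= -yf.
  exists (inK @` cyl a b); split; last by move=> _ [g /abU ? <-].
  + by left; left; exists a, b; split=> //; exists f.
  + by rewrite yf; exists f.
- case: (pselect (f = @zero L)) => [f0|f0].
    by apply: zeroC; rewrite yf f0 inK0.
  have [|a [b [b0 fab abU]]] := cyl_nbhs_nonzero oL _ f0; first by rewrite /= -yf.
  exists (inL @` cyl a b); split; last by move=> _ [g /abU ? <-].
  + by left; right; exists a, b; split=> //; exists f.
  + by rewrite yf; exists f.
Qed.

Lemma card_base_le (U : Type) (B : set U) h : infinite_set B ->
  [set: K] #<= B -> [set: L] #<= B -> base h #<= B.
Proof.
move=> Bi KB LB.
have sK : seqs [set: K] #<= B by exact: card_le_seqs.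
have sL : seqs [set: L] #<= B by exact: card_le_seqs.
apply: card_leU => //; first apply: card_leU => //.
- apply: (card_image2_le (g := fun a b => inK @` cyl a b) Bi sK sK).
  by move=> _ [a [b [_ _ ->]]]; exists a, b.
- apply: (card_image2_le (g := fun a b => inL @` cyl a b) Bi sL sL).
  by move=> _ [a [b [_ _ ->]]]; exists a, b.
- apply: (card_image2_le (g := star) Bi sK sL).
  by move=> _ [a [b [_ ->]]]; exists a, b.
Qed.

Definition above (h : K -> L) (W : set Y) := [set V | base h V /\ W `<=` V].

(** No set of [baseL] contains the cylinder; a [baseK] set above it takes its coordinates from [a]
    and [b]; a star above it takes [t] from [a], and only [s] ranges over [L]. *)
Lemma card_above_inK (U : Type) (B : set U) h a b W : infinite_set B ->
  [set: L] #<= B -> b <> [::] -> cyl a b !=set0 -> inK @` cyl a b `<=` W ->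
  above h W #<= B.
Proof.
move=> Bi LB b0 abn abW; have [f0 f0ab] := abn.
have sL : seqs [set: L] #<= B by exact: card_le_seqs.
have fin s : seqs [set x : K | List.In x s] #<= B.
  by apply: card_le_seqs => //; apply: finite_card_le => //; exact: finite_In.
apply: (card_le_trans (B := (above h W `&` baseK) `|` (above h W `&` base0 h))).
  apply: subset_card_le => V VW; have [bV WV] := VW.
  case: bV => [[]|] bV; [by left| |by right].
  case: bV VW WV => a' [b' [b'0 _ ->]] _ WV.
  have [g gab /esym/inKL[_ g0]] := WV _ (abW _ (ex_intro2 _ _ f0 f0ab erefl)).
  by case: (@cyl_nonzero _ a' b' b'0); rewrite -g0.
apply: card_leU => //.
- apply: (card_image2_le (g := fun a b => inK @` cyl a b) Bi (fin a) (fin b)).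
  move=> V [[_ WV] [a' [b' [_ _ VE]]]].
  have [|sa sb] := cyl_sub (a' := a') (b' := b') abn; last by exists a', b'.
  move=> f fab; have := WV _ (abW _ (ex_intro2 _ _ f fab erefl)).
  by rewrite VE => -[g gab /inK_inj <-].
- apply: (card_image2_le (g := star) Bi (fin a) sL).
  move=> V [[_ WV] [t [s [_ VE]]]]; exists t, s; split=> //.
  have [|sa _] // := cyl_sub (a' := t) (b' := [::]) abn.
  move=> f fab; have := WV _ (abW _ (ex_intro2 _ _ f fab erefl)).
  by rewrite VE => fs; rewrite -(inK_star t s).
Qed.

(** A star above the cylinder has [s] inside [a], so the coupling confines [t] to the preimage of
    [a]. Allowing a general [W] covers stars as well, since they contain such cylinders. *)
Lemma card_above_inL (U : Type) (B : set U) h a b W : infinite_set B ->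
  [set: L] #<= B -> [set x | List.In (h x) a] #<= B ->
  b <> [::] -> cyl a b !=set0 -> inL @` cyl a b `<=` W ->
  above h W #<= B.
Proof.
move=> Bi LB hB b0 abn abW; have [f0 f0ab] := abn.
have sL : seqs [set: L] #<= B by exact: card_le_seqs.
apply: (card_le_trans (B := baseL `|` (above h W `&` base0 h))).
  apply: subset_card_le => V VW; have [bV WV] := VW.
  case: bV => [[]|] bV; [|by left|by right].
  case: bV VW WV => a' [b' [b'0 _ ->]] _ WV.
  have [g gab /inKL[g0 _]] := WV _ (abW _ (ex_intro2 _ _ f0 f0ab erefl)).
  by case: (@cyl_nonzero _ a' b' b'0); rewrite -g0.
apply: card_leU => //.
- apply: (card_image2_le (g := fun a b => inL @` cyl a b) Bi sL sL).
  by move=> _ [a' [b' [_ _ ->]]]; exists a', b'.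
- have sh : seqs [set x | List.In (h x) a] #<= B by exact: card_le_seqs.
  apply: (card_image2_le (g := star) Bi sh sL).
  move=> V [[_ WV] [t [s [ts VE]]]]; exists t, s; split=> //.
  have [|sa _] := cyl_sub (a' := s) (b' := [::]) abn; last by move=> x /ts /sa.
  move=> f fab; have := WV _ (abW _ (ex_intro2 _ _ f fab erefl)).
  by rewrite VE => fs; rewrite -(inL_star t s).
Qed.

Lemma base_op_like h : infinite_set [set: K] -> infinite_set [set: L] ->
  card_lt [set: L] [set: K] ->
  (forall l, ~ ([set: K] #<= [set x | h x = l])) -> op_like K (base h).
Proof.
move=> Ki Li [LK nKL] fib.
have fibs a : ~ ([set: K] #<= [set x | List.In (h x) a]).
  elim: a => [|l a IH].
    by move=> le; apply: Ki; apply: card_le_finite le _; exact: finite_set0.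
  rewrite (_ : [set _ | _] = [set x | h x = l] `|` [set x | List.In (h x) a]).
    exact: not_card_leU.
  by apply/seteqP; split=> x /= [e|]; [left|right|left|right].
have [k _] := infinite_setN0 Ki; have [j _ jI] := card_le_exinj k LK.
have LrJ : [set: L] #<= range j.
  apply: (@card_le_inj _ _ _ _ j) => [x _|x y _ _]; [by exists x|exact: jI].
have nJ : ~ ([set: K] #<= range j).
  by move=> le; apply: nKL; apply: card_le_trans le (card_image_le _ _).
have inLC a b W : b <> [::] -> cyl a b !=set0 -> inL @` cyl a b `<=` W ->
    ~ ([set: K] #<= above h W).
  move=> b0 abn abW le.
  (* [M] stands for the maximum of lambda and the size of the preimage of [a]; a union of two sets
     smaller than kappa, it is itself smaller. *)
  pose M := range j `|` [set x | List.In (h x) a].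
  have LM : [set: L] #<= M.
    by apply: card_le_trans LrJ _; apply: subset_card_le => x; left.
  have := not_card_leU Ki nJ (fibs a); apply; apply: card_le_trans le _.
  apply: (card_above_inL _ LM _ b0 abn abW); first exact: card_le_infinite LM Li.
  by apply: subset_card_le => x; right.
move=> W [[[a [b [b0 abn WE]]]|[a [b [b0 abn WE]]]]|[t [s [_ WE]]]].
- move=> le; apply: nKL; apply: card_le_trans le _.
  by apply: (card_above_inK h Li _ b0 abn); rewrite ?WE.
- by apply: (inLC a b); rewrite ?WE.
(* A star contains a small-cube cylinder missing the collapsed point, and every superset of the star
   contains that cylinder. *)
- have [l _ sn] := ex_cyl_one s Li.
  apply: (inLC s [:: l]) => //; rewrite WE => _ [g [gs _] <-].
  by right; exists g.
Qed.

(** * The lower bound on the Noetherian type *)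

Lemma no_op_like_base (M : Type) :
  infinite_set [set: L] -> infinite_set [set: M] ->
  (forall f : K -> seq L, exists s, [set: M] #<= [set x | f x = s]) ->
  ~ exists B : set (set Y), basis B /\ op_like M B.
Proof.
move=> Li Mi pig [B [[Bo Bb] BM]].
have nb y (O : set Y) : open O -> O y -> exists W, [/\ B W, W y & W `<=` O].
  by move=> oO Oy; have [W [BW Wy] WO] := Bb y O (open_nbhs_nbhs (conj oO Oy)); exists W.
pose p := inK (@zero K).
have /choice[U UP] x : exists W, [/\ B W, W p & W `<=` star [:: x] [::]].
  by apply: nb; [exact: open_star|left; exists (@zero K)].
have /choice[sg sgP] x : exists s, cyl s [::] `<=` inL @^-1` U x.
  have [BU Up _] := UP x; apply: cyl_nbhs_zero; first exact: ((openYP _).1 (Bo _ BU)).2.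
  by rewrite /= -inK0.
have [s sM] := pig sg.
(* [U x] lies in [star [:: x] [::]], so all [x] with the same [U x] occur in one finite list [t]. *)
have Ufin v : finite_set ([set x | sg x = s] `&` U @^-1` [set v]).
  case: (pselect (exists x, U x = v)) => [[x0 Ux0]|nv]; last first.
    rewrite (_ : _ `&` _ = set0); first exact: finite_set0.
    by rewrite -subset0 => x [_ xv]; apply: nv; exists x.
  have [BU Up _] := UP x0.
  have [||t tU] := cyl_nbhs_zero (A := inK @^-1` U x0) => //.
    exact: ((openYP _).1 (Bo _ BU)).1.
  apply: sub_finite_set (finite_In t) => x [_ /= Ux].
  have [_ _ Us] := UP x.
  have [||tx _] := cyl_sub (a := t) (b := [::]) (a' := [:: x]) (b' := [::]).
  - by exists (@zero K).
  - move=> f /tU; rewrite /= Ux0 -Ux => /Us.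
    by rewrite -[star _ _ _]/((inK @^-1` star _ _) f) inK_star.
  - by apply: tx; left.
have MU := card_le_trans sM (card_ge_image_finite_fibers (card_le_infinite sM Mi) Ufin).
(* A one at [l] keeps the cylinder off the collapsed point, so it is open and holds a base member
   [W], which every [U x] with [sg x = s] contains. *)
have [l _ [g gsl]] := ex_cyl_one s Li.
have [||W [BW _ Wsub]] := nb (inL g) (inL @` cyl s [:: l]).
- exact: open_inL_cyl.
- by exists g.
apply: (BM W BW); apply: card_le_trans MU _; apply: subset_card_le => _ [x xs <-].
have [BU _ _] := UP x; split=> // y /Wsub[f [fs _] <-].
by apply: sgP; rewrite xs.
Qed.

End CollapsedSum.

(** * Pigeonhole principles and cofinality *)

Lemma card_le_pigeonhole (K L U : Type) (f : K -> seq L) (B : set U) :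
  infinite_set B -> [set: L] #<= B -> (forall s, [set x | f x = s] #<= B) ->
  [set: K] #<= B.
Proof.
move=> Bi LB fib; apply: (@card_le_fibers _ _ _ _ f) => //.
  apply: (card_le_trans (B := seqs [set: L])); first exact: subset_card_le.
  exact: card_le_seqs.
by move=> s; rewrite setTI; exact: fib.
Qed.

(** If all fibres were smaller than kappa, the endpoints of segments bounding their sizes would form
    a cofinal set of size at most lambda. *)
Lemma pigeonhole_cf (K L : Type) : infinite_set [set: K] -> infinite_set [set: L] ->
  card_lt [set: L] [set: K] -> ~ cf_le L K ->
  forall f : K -> seq L, exists s, [set: K] #<= [set x | f x = s].
Proof.
move=> Ki Li [LK nKL] ncf f; apply: contrapT => nex.
have {}nex s : ~ ([set: K] #<= [set x | f x = s]) by move=> le; apply: nex; exists s.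
have [R iR] := ex_initial_wellorder K; case: (iR) => wf tr tri seg.
(* A fibre embedding in no segment would receive all of [K] by the greedy recursion. *)
have /choice[c cP] s : exists c, [set x | f x = s] #<= [set y | R y c].
  apply: contrapT => nc; apply: (nex s).
  apply: (wf_card_le wf tri) => x _ le; apply: nc; exists x.
  by apply: card_le_trans le _; apply: subset_card_le => y [].
apply: ncf; exists R; split=> //; exists (range c); split; last first.
  apply: card_le_trans (card_image_le _ _) _.
  apply: (card_le_trans (B := seqs [set: L])); first exact: subset_card_le.
  exact: card_le_seqs.
(* With [x] above every [c s], all fibres embed in the segment below [x], so kappa would be at most
   the maximum of lambda and the size of that segment. *)
move=> x; apply: contrapT => nx.
have cx s : R (c s) x.
  case: (tri (c s) x) => // [e|r]; case: nx; exists (c s); try by exists s.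
    by left.
  by right.
have [k _] := infinite_setN0 Ki; have [j _ jI] := card_le_exinj k LK.
pose M := range j `|` [set y | R y x].
have LM : [set: L] #<= M.
  apply: (@card_le_inj _ _ _ _ j) => [y _|y z _ _]; last exact: jI.
  by left; exists y.
have : ~ ([set: K] #<= M).
  apply: not_card_leU => //; last by have [] := seg x.
  by move=> le; apply: nKL; apply: card_le_trans le (card_image_le _ _).
apply; apply: (card_le_pigeonhole (f := f) _ LM); first exact: card_le_infinite LM Li.
move=> s; apply: card_le_trans (cP s) _; apply: subset_card_le => y yc.
by right; exact: tr (cx s).
Qed.

(** Otherwise every fibre embeds in [M], and [K] would embed in the larger of [L] and [M]. *)
Lemma pigeonhole_lt (K L M : Type) : infinite_set [set: L] ->
  infinite_set [set: M] -> ~ ([set: K] #<= [set: L]) -> ~ ([set: K] #<= [set: M]) ->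
  forall f : K -> seq L, exists s, [set: M] #<= [set x | f x = s].
Proof.
move=> Li Mi nL nM f; apply: contrapT => nex.
have fM s : [set x | f x = s] #<= [set: M].
  by case: (card_le_total [set: M] [set x | f x = s]) => // le; case: nex; exists s.
case: (card_le_total [set: L] [set: M]) => le.
  by apply: nM; exact: card_le_pigeonhole le fM.
apply: nL; apply: (card_le_pigeonhole Li (card_lexx _) (f := f)) => s.
exact: card_le_trans (fM s) le.
Qed.

(** [h] sends [x] to the code in [L] of a chosen element of [C] at or above [x]; points with equal
    codes lie at or below the same element, hence are fewer than kappa. *)
Lemma cf_le_fibers (K L : Type) : infinite_set [set: K] -> infinite_set [set: L] ->
  cf_le L K ->
  exists h : K -> L, forall l, ~ ([set: K] #<= [set x | h x = l]).
Proof.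
move=> Ki Li [R [[wf tr tri seg] [C [Ccof CL]]]].
have [l0 _] := infinite_setN0 Li; have [j _ jI] := card_le_exinj l0 CL.
have /choice[c cP] x : exists y, C y /\ (x = y \/ R x y).
  by have [y Cy xy] := Ccof x; exists y.
exists (j \o c) => l le.
have [x0 jx0] := card_le_nonempty (infinite_setN0 Ki) le.
have : ~ ([set: K] #<= [set c x0] `|` [set y | R y (c x0)]).
  apply: not_card_leU => //; last by have [] := seg (c x0).
  by move=> le1; apply: Ki; apply: card_le_finite le1 (finite_set1 _).
apply; apply: card_le_trans le _; apply: subset_card_le => x /= jx.
have <- : c x = c x0 by apply: jI; [exact: (cP x).1|exact: (cP x0).1|rewrite jx -jx0].
by case: (cP x) => _ [|]; [left|right].
Qed.

Theorem theorem3p34 (K L : Type) :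
  infinite_set [set: K] -> infinite_set [set: L] ->
  card_lt [set: L] [set: K] ->
  (~ cf_le L K -> exists P : Type, is_succ_card K P /\ Nt_is (Yspace K L) P) /\
  (cf_le L K -> Nt_is (Yspace K L) K).
Proof.
move=> Ki Li LK; have [leLK nKL] := LK; split=> [ncf|cf].
  have [P succP] := ex_succ_card K; case: (succP) => -[KP nPK] Pmin.
  exists P; split=> //; split.
  - exact: card_le_infinite KP Ki.
  - have [l _] := infinite_setN0 Li.
    (* A constant map suffices here, since only the size of the base is used. *)
    exists (base (fun=> l)); split; first exact: base_basis.
    move=> W _ le; apply: nPK; apply: card_le_trans le _.
    apply: (card_le_trans (B := base (fun=> l))); first by apply: subset_card_le => V [].
    exact: card_base_le.
  - move=> N Ni [_ nPN] [B [bB opB]].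
    (* As [P] is least above [K], a smaller [N] is at most [K], so an [N]-like base would also be
       [K]-like. *)
    have NK : [set: N] #<= [set: K].
      case: (card_le_total [set: N] [set: K]) => // KN.
      by apply: contrapT => nNK; apply: nPN; exact: Pmin.
    apply: (no_op_like_base Li Ki (pigeonhole_cf Ki Li LK ncf)).
    by exists B; split=> // W BW le; apply: (opB W BW); exact: card_le_trans NK le.
have [h hfib] := cf_le_fibers Ki Li cf.
split=> //; first by exists (base h); split; [exact: base_basis|exact: base_op_like].
move=> N Ni [_ nKN]; apply: no_op_like_base => //; exact: pigeonhole_lt.
Qed.
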